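(* Let $S$ be a commutative semiring and let $X,Y$ be sets. There is an isomorphism of $S$-modules $$S[[X+Y]]\;\cong\;\big(S[X]\otimes S[Y]\multimap S\big)$$ between formal distributions in the coproduct $X+Y$ and relations on $X$ and $Y$. Under the canonical such isomorphism, the formal distribution in $S[[X+X]]$ corresponding to the comparison relation $\mathrm{cp}\colon S[X]\otimes S[X]\to S$ is the function $\mathcal{M}_{\mathbb{N}}(X+X)\to S$ given by $$\varphi\longmapsto\begin{cases}1&\text{if }\varphi(\kappa_1-)=\varphi(\kappa_2-)\text{ in }\mathcal{M}_{\mathbb{N}}(X),\\0&\text{otherwise.}\end{cases}$$
   Context: For a commutative semiring $R$, $\mathcal{M}_R(X)$ is the set of functions $\varphi\colon X\to R$ with finite support $\{x\mid\varphi(x)\ne0\}$; it is the free $R$-module on the set $X$. $S$-modules are commutative monoids with a scalar multiplication by $S$; $\mathbf{Mod}_S$ is the symmetric monoidal closed category of $S$-modules and linear maps, with $\otimes$ classifying bilinear maps and $M\multimap N$ the module of linear maps $M\to N$. For a set $X$, $S[X]=\mathcal{M}_S(\mathcal{M}_{\mathbb{N}}(X))$ is the $S$-module of (finite) multivariate polynomials with variables in $X$, and $S[[X]]=S^{\mathcal{M}_{\mathbb{N}}(X)}$ is the $S$-module of all functions $\mathcal{M}_{\mathbb{N}}(X)\to S$, with pointwise structure (possibly infinite polynomials, or formal distributions). $X+Y$ is the disjoint union with coprojections $\kappa_1,\kappa_2$; for $\varphi\in\mathcal{M}_{\mathbb{N}}(X+Y)$, $\varphi(\kappa_i-)$ denotes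 the function $\varphi\circ\kappa_i$. The comparison relation $\mathrm{cp}\colon S[X]\otimes S[X]\to S$ is given by $\mathrm{cp}(p\otimes p')=\sum_{\varphi\in\mathcal{M}_{\mathbb{N}}(X)}p(\varphi)\cdot p'(\varphi)$. The canonical isomorphism sends $p\in S[[X+Y]]$ to the linear map $S[X]\otimes S[Y]\to S$ determined on generators by $1\varphi\otimes1\psi\mapsto p(\varphi\star\psi)$, for $\varphi\in\mathcal{M}_{\mathbb{N}}(X)$, $\psi\in\mathcal{M}_{\mathbb{N}}(Y)$. Here $\varphi\star\psi\in\mathcal{M}_{\mathbb{N}}(X+Y)$ is the multiset with $(\varphi\star\psi)(\kappa_1x)=\varphi(x)$ and $(\varphi\star\psi)(\kappa_2y)=\psi(y)$, and $1\varphi$ is the generator of the free module given by $\varphi$. *)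

(* Defs.v *)
From HB Require Import structures.
From mathcomp Require Import all_boot all_algebra.
From mathcomp Require Import finmap multiset generic_quotient.
From mathcomp Require Import boolp classical_sets functions cardinality fsbigop.

Set Implicit Arguments.
Unset Strict Implicit.
Unset Printing Implicit Defensive.

Import GRing.Theory.
Local Open Scope quotient_scope.
Local Open Scope classical_set_scope.
Local Open Scope mset_scope.
Local Open Scope fset_scope.
Local Open Scope ring_scope.

(* Sets are [choiceType]s; this is no restriction, since by classical choice  *)
(* every type T is one, as {classic T}. The semiring may be trivial (0 = 1).  *)
(* M_N(X) is {mset X} = {fsfun X -> nat with 0}, and S as an S-module is S^o. *)

Section LinearMaps.
Variables (S : comPzSemiRingType) (M N : lSemiModType S).

Definition lhom : Type := {linear M -> N}.

HB.instance Definition _ := gen_eqMixin lhom.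
HB.instance Definition _ := gen_choiceMixin lhom.

Lemma lhomP (f g : lhom) : f =1 g <-> f = g.
Proof.
split=> [fg|->//]; case: f g fg => [f cf] [g cg] /= /funext fg.
subst g; congr GRing.Linear.Pack; case: cf cg => [[cf] [df]] [[cg] [dg]].
by rewrite (Prop_irrelevance cf cg) (Prop_irrelevance df dg).
Qed.

Definition lhom_zero : lhom := \0%R.
Definition lhom_add (f g : lhom) : lhom := f \+ g.

Fact lhom_addA : associative lhom_add.
Proof. by move=> f g h; apply/lhomP => x /=; rewrite addrA. Qed.
Fact lhom_addC : commutative lhom_add.
Proof. by move=> f g; apply/lhomP => x /=; rewrite addrC. Qed.
Fact lhom_add0 : left_id lhom_zero lhom_add.
Proof. by move=> f; apply/lhomP => x /=; rewrite add0r. Qed.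

HB.instance Definition _ :=
  GRing.isNmodule.Build lhom lhom_addA lhom_addC lhom_add0.

Definition lhom_scale_fun (a : S) (f : lhom) (x : M) : N := a *: f x.

Fact lhom_scale_semilinear a f : semilinear (lhom_scale_fun a f).
Proof.
split=> [b x|x y]; rewrite /lhom_scale_fun.
  by rewrite linearZ /= !scalerA mulrC.
by rewrite raddfD scalerDr.
Qed.

HB.instance Definition _ a f := GRing.isSemilinear.Build S M N *:%R
  (lhom_scale_fun a f) (lhom_scale_semilinear a f).

Definition lhom_scale (a : S) (f : lhom) : lhom := lhom_scale_fun a f.

Fact lhom_scaleA a b f :
  lhom_scale a (lhom_scale b f) = lhom_scale (a * b) f.
Proof. by apply/lhomP => x /=; rewrite /lhom_scale_fun /= scalerA. Qed.
Fact lhom_scale0 f : lhom_scale 0 f = 0.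
Proof. by apply/lhomP => x /=; rewrite /lhom_scale_fun scale0r. Qed.
Fact lhom_scale1 : left_id 1 lhom_scale.
Proof. by move=> f; apply/lhomP => x /=; rewrite /lhom_scale_fun scale1r. Qed.
Fact lhom_scaleDr : right_distributive lhom_scale +%R.
Proof.
by move=> a f g; apply/lhomP => x /=; rewrite /lhom_scale_fun /= scalerDr.
Qed.
Fact lhom_scaleDl f : {morph lhom_scale^~ f : a b / a + b}.
Proof.
by move=> a b; apply/lhomP => x /=; rewrite /lhom_scale_fun /= scalerDl.
Qed.

HB.instance Definition _ := GRing.Nmodule_isLSemiModule.Build S lhom
  lhom_scaleA lhom_scale0 lhom_scale1 lhom_scaleDr lhom_scaleDl.

Lemma lhom0 (f : lhom) : f 0 = 0. Proof. exact: raddf0. Qed.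
Lemma lhomD (f : lhom) x y : f (x + y) = f x + f y. Proof. exact: raddfD. Qed.
Lemma lhomZ (f : lhom) a x : f (a *: x) = a *: f x. Proof. exact: linearZ. Qed.
Lemma lhom0E x : (0 : lhom) x = 0. Proof. by []. Qed.
Lemma lhomDE (f g : lhom) x : (f + g) x = f x + g x. Proof. by []. Qed.
Lemma lhomZE a (f : lhom) x : (a *: f) x = a *: f x. Proof. by []. Qed.

End LinearMaps.

Notation "M ⊸ N" := (lhom M N) (at level 70, right associativity)
  : type_scope.

Section FreeModule.
Variables (S : comPzSemiRingType) (X : choiceType).

Definition free_mod : Type := {fsfun X -> S with 0}.

HB.instance Definition _ := Choice.copy free_mod {fsfun X -> S with 0}.

Definition free_add (f g : free_mod) : free_mod :=
  [fsfun x in finsupp f `|` finsupp g => f x + g x | 0].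
Definition free_scale (a : S) (f : free_mod) : free_mod :=
  [fsfun x in finsupp f => a * f x | 0].
Definition free_zero : free_mod := [fsfun with 0].

Fact free_addE f g x : free_add f g x = f x + g x.
Proof.
rewrite fsfunE in_fsetU; case: finsuppP => [|] //= _; case: finsuppP => //=.
by rewrite addr0.
Qed.
Fact free_scaleE a f x : free_scale a f x = a * f x.
Proof. by rewrite fsfunE; case: finsuppP => //=; rewrite mulr0. Qed.
Fact free_zeroE x : free_zero x = 0.
Proof. by rewrite fsfunE. Qed.

Fact free_addA : associative free_add.
Proof. by move=> f g h; apply/fsfunP => x; rewrite !free_addE addrA. Qed.
Fact free_addC : commutative free_add.
Proof. by move=> f g; apply/fsfunP => x; rewrite !free_addE addrC. Qed.
Fact free_add0 : left_id free_zero free_add.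
Proof. by move=> f; apply/fsfunP => x; rewrite free_addE free_zeroE add0r. Qed.

HB.instance Definition _ :=
  GRing.isNmodule.Build free_mod free_addA free_addC free_add0.

Fact free_scaleA a b f :
  free_scale a (free_scale b f) = free_scale (a * b) f.
Proof. by apply/fsfunP => x; rewrite !free_scaleE mulrA. Qed.
Fact free_scale0 f : free_scale 0 f = 0.
Proof. by apply/fsfunP => x; rewrite free_scaleE free_zeroE mul0r. Qed.
Fact free_scale1 : left_id 1 free_scale.
Proof. by move=> f; apply/fsfunP => x; rewrite free_scaleE mul1r. Qed.
Fact free_scaleDr : right_distributive free_scale +%R.
Proof.
by move=> a f g; apply/fsfunP => x; rewrite !(free_addE, free_scaleE) mulrDr.
Qed.
Fact free_scaleDl f : {morph free_scale^~ f : a b / a + b}.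
Proof.
by move=> a b; apply/fsfunP => x; rewrite !(free_addE, free_scaleE) mulrDl.
Qed.

HB.instance Definition _ := GRing.Nmodule_isLSemiModule.Build S free_mod
  free_scaleA free_scale0 free_scale1 free_scaleDr free_scaleDl.

Lemma free0E x : (0 : free_mod) x = 0. Proof. exact: free_zeroE. Qed.
Lemma freeDE (f g : free_mod) x : (f + g) x = f x + g x.
Proof. exact: free_addE. Qed.
Lemma freeZE a (f : free_mod) x : (a *: f) x = a * f x.
Proof. exact: free_scaleE. Qed.

Definition free_gen (x : X) : free_mod := [fsfun y in [fset x] => 1 | 0].

Lemma free_genE x y : free_gen x y = (y == x)%:R.
Proof. by rewrite fsfunE inE; case: eqP. Qed.

Lemma free_sumE I (r : seq I) (P : pred I) (F : I -> free_mod) x :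
  (\sum_(i <- r | P i) F i) x = \sum_(i <- r | P i) F i x.
Proof.
by elim/big_rec2: _ => [|i a b _ <-]; rewrite ?free0E ?freeDE.
Qed.

Lemma free_decomp (f : free_mod) :
  f = \sum_(x <- finsupp f) f x *: free_gen x.
Proof.
apply/fsfunP => y; rewrite free_sumE.
under eq_bigr do rewrite freeZE free_genE.
case: finsuppP => [yNf|yf].
  rewrite big1_seq // => x /andP[_ xf].
  by rewrite (_ : y == x = false) ?mulr0 //; apply: contraNF yNf => /eqP->.
rewrite (big_fsetD1 y) //= eqxx mulr1 big1_seq ?addr0 // => x.
by rewrite !inE => /andP[_ /andP[/negPf xy _]]; rewrite eq_sym xy mulr0.
Qed.

Section Extension.
Variables (M : lSemiModType S) (h : X -> M).

Definition free_ext_fun (f : free_mod) : M := \sum_(x <- finsupp f) f x *: h x.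

Lemma free_ext_widen (A : {fset X}) f : finsupp f `<=` A ->
  free_ext_fun f = \sum_(x <- A) f x *: h x.
Proof.
move=> fA; apply: big_fset_incl => // x _ xNf.
by rewrite fsfun_dflt // scale0r.
Qed.

Fact free_ext_semilinear : semilinear free_ext_fun.
Proof.
split=> [a f|f g].
  rewrite (@free_ext_widen (finsupp f)); last exact: finsupp_sub.
  by rewrite /free_ext_fun scaler_sumr; apply: eq_bigr => x _;
    rewrite freeZE scalerA.
rewrite (@free_ext_widen (finsupp f `|` finsupp g)); last exact: finsupp_sub.
rewrite (free_ext_widen (fsubsetUl (finsupp f) (finsupp g))).
rewrite (free_ext_widen (fsubsetUr (finsupp f) (finsupp g))).
by rewrite -big_split; apply: eq_bigr => x _; rewrite freeDE scalerDl.
Qed.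

HB.instance Definition _ := GRing.isSemilinear.Build S free_mod M *:%R
  free_ext_fun free_ext_semilinear.

Definition free_ext : free_mod ⊸ M := free_ext_fun.

Lemma free_ext_gen x : free_ext (free_gen x) = h x.
Proof.
rewrite /= (@free_ext_widen [fset x]); last exact: finsupp_sub.
by rewrite big_seq_fset1 free_genE eqxx scale1r.
Qed.

End Extension.

Lemma free_lin_eq (M : lSemiModType S) (f g : free_mod ⊸ M) :
  (forall x, f (free_gen x) = g (free_gen x)) -> f = g.
Proof.
move=> fg; apply/lhomP => u; rewrite (free_decomp u) !raddf_sum /=.
by apply: eq_bigr => x _; rewrite !linearZ /= fg.
Qed.

End FreeModule.

(* M ⊗ N is the free module on M * N modulo the least module congruence       *)
(* making (x, y) |-> x ⊗ y bilinear.                                          *)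
Section TensorProduct.
Variables (S : comPzSemiRingType) (M N : lSemiModType S).

Local Notation F := (free_mod S (M * N)%type).
Local Notation "x ## y" := (free_gen S (x, y)) (at level 35).

Inductive tensor_cong : F -> F -> Prop :=
| tcong_refl u : tensor_cong u u
| tcong_sym u v : tensor_cong u v -> tensor_cong v u
| tcong_trans u v w : tensor_cong u v -> tensor_cong v w -> tensor_cong u w
| tcong_add u u' v v' :
    tensor_cong u u' -> tensor_cong v v' -> tensor_cong (u + v) (u' + v')
| tcong_scale a u v : tensor_cong u v -> tensor_cong (a *: u) (a *: v)
| tcong_addl x x' y : tensor_cong ((x + x') ## y) (x ## y + x' ## y)
| tcong_addr x y y' : tensor_cong (x ## (y + y')) (x ## y + x ## y')
| tcong_scalel a x y : tensor_cong ((a *: x) ## y) (a *: (x ## y))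
| tcong_scaler a x y : tensor_cong (x ## (a *: y)) (a *: (x ## y)).

Definition tensor_rel : rel F := fun u v => `[< tensor_cong u v >].

Fact tensor_rel_equiv : equiv_class_of tensor_rel.
Proof.
split=> [u|u v|v u w]; rewrite /tensor_rel; first exact/asboolP/tcong_refl.
  by apply/asboolP/asboolP; exact: tcong_sym.
by move=> /asboolP uv /asboolP vw; apply/asboolP; exact: tcong_trans vw.
Qed.

Canonical tensor_equiv := EquivRelPack tensor_rel_equiv.

Definition tensor : Type := {eq_quot tensor_equiv}.

HB.instance Definition _ : Choice tensor := Choice.on tensor.
HB.instance Definition _ : EqQuotient F tensor_equiv tensor :=
  EqQuotient.on tensor.

Lemma tensor_pieq (u v : F) : \pi_tensor u = \pi_tensor v <-> tensor_cong u v.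
Proof.
by split=> [/eqmodP/asboolP //|uv]; apply/eqmodP/asboolP.
Qed.

Lemma tensor_repr (u : F) : tensor_cong (repr (\pi_tensor u)) u.
Proof. by apply/tensor_pieq; rewrite reprK. Qed.

Lemma tensorW (P : tensor -> Prop) :
  (forall u : F, P (\pi_tensor u)) -> forall t, P t.
Proof. by move=> Pu t; rewrite -[t]reprK. Qed.

Definition tensor_zero : tensor := \pi_tensor 0.
Definition tensor_add (t u : tensor) : tensor := \pi_tensor (repr t + repr u).
Definition tensor_scale (a : S) (t : tensor) : tensor :=
  \pi_tensor (a *: repr t).

Fact tensor_addE u v :
  tensor_add (\pi_tensor u) (\pi_tensor v) = \pi_tensor (u + v).
Proof. by apply/tensor_pieq; apply: tcong_add; exact: tensor_repr. Qed.
Fact tensor_scaleE a u : tensor_scale a (\pi_tensor u) = \pi_tensor (a *: u).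
Proof. by apply/tensor_pieq; apply: tcong_scale; exact: tensor_repr. Qed.

Fact tensor_addA : associative tensor_add.
Proof.
apply: tensorW => u; apply: tensorW => v; apply: tensorW => w.
by rewrite !tensor_addE addrA.
Qed.
Fact tensor_addC : commutative tensor_add.
Proof.
by apply: tensorW => u; apply: tensorW => v; rewrite !tensor_addE addrC.
Qed.
Fact tensor_add0 : left_id tensor_zero tensor_add.
Proof. by apply: tensorW => u; rewrite tensor_addE add0r. Qed.

HB.instance Definition _ :=
  GRing.isNmodule.Build tensor tensor_addA tensor_addC tensor_add0.

Lemma tensor_piD u v : \pi_tensor (u + v) = \pi_tensor u + \pi_tensor v.
Proof. by rewrite -tensor_addE. Qed.

Fact tensor_scaleA a b t :
  tensor_scale a (tensor_scale b t) = tensor_scale (a * b) t.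
Proof. by move: t; apply: tensorW => u; rewrite !tensor_scaleE scalerA. Qed.
Fact tensor_scale0 t : tensor_scale 0 t = 0.
Proof. by move: t; apply: tensorW => u; rewrite tensor_scaleE scale0r. Qed.
Fact tensor_scale1 : left_id 1 tensor_scale.
Proof. by apply: tensorW => u; rewrite tensor_scaleE scale1r. Qed.
Fact tensor_scaleDr : right_distributive tensor_scale +%R.
Proof.
move=> a; apply: tensorW => u; apply: tensorW => v.
by rewrite /= -tensor_piD !tensor_scaleE scalerDr tensor_piD.
Qed.
Fact tensor_scaleDl t : {morph tensor_scale^~ t : a b / a + b}.
Proof.
move: t; apply: tensorW => u a b.
by rewrite /= !tensor_scaleE scalerDl tensor_piD.
Qed.

HB.instance Definition _ := GRing.Nmodule_isLSemiModule.Build S tensor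
  tensor_scaleA tensor_scale0 tensor_scale1 tensor_scaleDr tensor_scaleDl.

Lemma tensor_piZ a u : \pi_tensor (a *: u) = a *: \pi_tensor u.
Proof. by rewrite -tensor_scaleE. Qed.

Definition tens (x : M) (y : N) : tensor := \pi_tensor (x ## y).

Lemma tensDl x x' y : tens (x + x') y = tens x y + tens x' y.
Proof. by rewrite -tensor_piD; apply/tensor_pieq/tcong_addl. Qed.
Lemma tensDr x y y' : tens x (y + y') = tens x y + tens x y'.
Proof. by rewrite -tensor_piD; apply/tensor_pieq/tcong_addr. Qed.
Lemma tensZl a x y : tens (a *: x) y = a *: tens x y.
Proof. by rewrite -tensor_piZ; apply/tensor_pieq/tcong_scalel. Qed.
Lemma tensZr a x y : tens x (a *: y) = a *: tens x y.
Proof. by rewrite -tensor_piZ; apply/tensor_pieq/tcong_scaler. Qed.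

(* Universal property: a bilinear map M * N -> P is a linear map              *)
(* M ⊸ (N ⊸ P), and factors uniquely through [tens].                          *)
Section Lift.
Variables (P : lSemiModType S) (b : M ⊸ (N ⊸ P)).

Let ext : F ⊸ P := free_ext (fun xy : M * N => b xy.1 xy.2).

Definition tensor_lift_fun (t : tensor) : P := ext (repr t).

Let ext_cong u v : tensor_cong u v -> ext u = ext v.
Proof.
elim=> {u v} [//|//|u v w _ -> //|u u' v v' _ IH _ IH'|a u v _ IH||||].
- by rewrite !lhomD IH IH'.
- by rewrite !lhomZ IH.
- by move=> x x' y; rewrite lhomD !free_ext_gen /= lhomD lhomDE.
- by move=> x y y'; rewrite lhomD !free_ext_gen /= lhomD.
- by move=> a x y; rewrite lhomZ !free_ext_gen /= lhomZ lhomZE.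
- by move=> a x y; rewrite lhomZ !free_ext_gen /= lhomZ.
Qed.

Let tensor_lift_pi u : tensor_lift_fun (\pi_tensor u) = ext u.
Proof. exact/ext_cong/tensor_repr. Qed.

Fact tensor_lift_semilinear : semilinear tensor_lift_fun.
Proof.
split=> [a|]; apply: tensorW => u.
  by rewrite -tensor_piZ !tensor_lift_pi lhomZ.
by apply: tensorW => v; rewrite -tensor_piD !tensor_lift_pi lhomD.
Qed.

HB.instance Definition _ := GRing.isSemilinear.Build S tensor P *:%R
  tensor_lift_fun tensor_lift_semilinear.

Definition tensor_lift : tensor ⊸ P := tensor_lift_fun.

Lemma tensor_liftE x y : tensor_lift (tens x y) = b x y.
Proof. by rewrite /= tensor_lift_pi free_ext_gen. Qed.

End Lift.

Lemma tensor_lin_eq (P : lSemiModType S) (f g : tensor ⊸ P) :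
  (forall x y, f (tens x y) = g (tens x y)) -> f = g.
Proof.
move=> fg; apply/lhomP; apply: tensorW => u; rewrite (free_decomp u).
elim/big_rec: _ => [|[x y] v _ IH].
  by rewrite -[\pi_tensor 0]/(0 : tensor) !lhom0.
rewrite tensor_piD tensor_piZ -/(tens x y).
by rewrite !lhomD !lhomZ fg IH.
Qed.

End TensorProduct.

Notation "M ⊗ N" := (tensor M N) (at level 40, left associativity)
  : type_scope.

Definition linear_iso (S : comPzSemiRingType) (U V : lSemiModType S)
    (f : {linear U -> V}) : Prop :=
  exists g : {linear V -> U}, cancel f g /\ cancel g f.

(* S[X] *)
Notation mpolys S X := (free_mod S {mset X}).

(* S[[X]] *)
Section FormalDistributions.
Variables (S : comPzSemiRingType) (X : choiceType).

Definition fdistr : Type := {mset X} -> S.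

HB.instance Definition _ := GRing.Nmodule.copy fdistr ({mset X} -> S).

Definition fdistr_scale (a : S) (p : fdistr) : fdistr := fun phi => a * p phi.

Fact fdistr_scaleA a b p :
  fdistr_scale a (fdistr_scale b p) = fdistr_scale (a * b) p.
Proof. by apply/funext => phi; rewrite /fdistr_scale mulrA. Qed.
Fact fdistr_scale0 p : fdistr_scale 0 p = 0.
Proof. by apply/funext => phi; rewrite /fdistr_scale mul0r. Qed.
Fact fdistr_scale1 : left_id 1 fdistr_scale.
Proof. by move=> p; apply/funext => phi; rewrite /fdistr_scale mul1r. Qed.
Fact fdistr_scaleDr : right_distributive fdistr_scale +%R.
Proof. by move=> a p q; apply/funext => phi; rewrite /fdistr_scale mulrDr. Qed.
Fact fdistr_scaleDl p : {morph fdistr_scale^~ p : a b / a + b}.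
Proof. by move=> a b; apply/funext => phi; rewrite /fdistr_scale mulrDl. Qed.

HB.instance Definition _ := GRing.Nmodule_isLSemiModule.Build S fdistr
  fdistr_scaleA fdistr_scale0 fdistr_scale1 fdistr_scaleDr fdistr_scaleDl.

End FormalDistributions.

Section Coproduct.
Variables X Y : choiceType.

(* phi ⋆ psi *)
Definition mset_star (phi : {mset X}) (psi : {mset Y}) : {mset X + Y} :=
  [fsfun z in [fset inl x | x in finsupp phi]
                `|` [fset inr y | y in finsupp psi]
     => match z with inl x => phi x | inr y => psi y end
   | 0%N].

Lemma mset_star_inl phi psi x : mset_star phi psi (inl x) = phi x.
Proof.
rewrite fsfunE; case: ifP => // /negbT; rewrite in_fsetU negb_or => /andP[+ _].
apply: contraNeq => phix; apply/imfsetP; exists x => //=.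
by rewrite mem_finsupp eq_sym.
Qed.

Lemma mset_star_inr phi psi y : mset_star phi psi (inr y) = psi y.
Proof.
rewrite fsfunE; case: ifP => // /negbT; rewrite in_fsetU negb_or => /andP[_].
apply: contraNeq => psiy; apply/imfsetP; exists y => //=.
by rewrite mem_finsupp eq_sym.
Qed.

(* phi(κ_1 -) and phi(κ_2 -), as multisets *)
Definition mset_inl (phi : {mset X + Y}) : {mset X} :=
  [fsfun x in [fset x in pmap (fun z => if z is inl x then Some x else None)
                             (finsupp phi)] => phi (inl x) | 0%N].
Definition mset_inr (phi : {mset X + Y}) : {mset Y} :=
  [fsfun y in [fset y in pmap (fun z => if z is inr y then Some y else None)
                             (finsupp phi)] => phi (inr y) | 0%N].

Lemma mset_inlE phi x : mset_inl phi x = phi (inl x).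
Proof.
rewrite fsfunE; case: ifP => // /negbT; apply: contraNeq => phix.
rewrite inE /= mem_pmap; apply/mapP; exists (inl x) => //.
by rewrite mem_finsupp eq_sym.
Qed.

Lemma mset_inrE phi y : mset_inr phi y = phi (inr y).
Proof.
rewrite fsfunE; case: ifP => // /negbT; apply: contraNeq => phiy.
rewrite inE /= mem_pmap; apply/mapP; exists (inr y) => //.
by rewrite mem_finsupp eq_sym.
Qed.

End Coproduct.

Section Canonical.
Variables (S : comPzSemiRingType) (X Y : choiceType).

Definition canon_fun (p : fdistr S (X + Y)%type) :
    mpolys S X ⊗ mpolys S Y ⊸ S^o :=
  tensor_lift (free_ext (fun phi : {mset X} =>
    free_ext (fun psi : {mset Y} => p (mset_star phi psi) : S^o))).

Lemma canon_funE p phi psi :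
  canon_fun p (tens (free_gen S phi) (free_gen S psi)) = p (mset_star phi psi).
Proof. by rewrite tensor_liftE !free_ext_gen. Qed.

Lemma mpolys_tensor_eq (P : lSemiModType S)
    (f g : mpolys S X ⊗ mpolys S Y ⊸ P) :
  (forall phi psi, f (tens (free_gen S phi) (free_gen S psi)) =
                   g (tens (free_gen S phi) (free_gen S psi))) -> f = g.
Proof.
move=> fg; apply: tensor_lin_eq => u v; rewrite (free_decomp u) (free_decomp v).
elim/big_rec: _ => [|phi u' _ IHu].
  by rewrite -(scale0r 0) tensZl !lhomZ !scale0r.
rewrite tensDl !lhomD IHu; congr (_ + _).
elim/big_rec: _ => [|psi v' _ IHv].
  by rewrite -(scale0r 0) tensZr !lhomZ !scale0r.
rewrite tensDr !lhomD IHv; congr (_ + _).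
by rewrite tensZl tensZr 2!lhomZ fg -2!lhomZ.
Qed.

Fact canon_semilinear : semilinear canon_fun.
Proof.
by split=> [a p|p q]; apply: mpolys_tensor_eq => phi psi;
   rewrite ?lhomZE ?lhomDE !canon_funE.
Qed.

HB.instance Definition _ := GRing.isSemilinear.Build S
  (fdistr S (X + Y)%type) (mpolys S X ⊗ mpolys S Y ⊸ S^o) *:%R
  canon_fun canon_semilinear.

Definition canon_map :
  {linear fdistr S (X + Y)%type -> (mpolys S X ⊗ mpolys S Y ⊸ S^o)} :=
  canon_fun.

Lemma canon_mapE p phi psi :
  canon_map p (tens (free_gen S phi) (free_gen S psi)) = p (mset_star phi psi).
Proof. exact: canon_funE. Qed.

End Canonical.

Section Comparison.
Variables (S : comPzSemiRingType) (X : choiceType).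

Definition cp_fun (p p' : mpolys S X) : S^o :=
  \sum_(phi \in [set: {mset X}]) p phi * p' phi.

Lemma cp_funE (A : {fset {mset X}}) p p' : finsupp p `<=` A ->
  cp_fun p p' = \sum_(phi <- A) p phi * p' phi.
Proof.
move=> /fsubsetP pA; rewrite /cp_fun (fsbigTE A) // => phi phiA.
by rewrite fsfun_dflt ?mul0r //; apply: contraNN phiA => /pA.
Qed.

Fact cp_semilinear_r p : semilinear (cp_fun p).
Proof.
split=> [a q|q q']; rewrite !(@cp_funE (finsupp p)) //.
  by rewrite scaler_sumr; apply: eq_bigr => phi _; rewrite freeZE mulrCA.
by rewrite -big_split; apply: eq_bigr => phi _; rewrite freeDE mulrDr.
Qed.

HB.instance Definition _ p := GRing.isSemilinear.Build S (mpolys S X) S^o *:%R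
  (cp_fun p) (cp_semilinear_r p).

Definition cp_curry (p : mpolys S X) : mpolys S X ⊸ S^o := cp_fun p.

Fact cp_semilinear_l : semilinear cp_curry.
Proof.
split=> [a p|p q]; apply/lhomP => r /=.
  rewrite lhomZE /= !(@cp_funE (finsupp p)) //; last exact: finsupp_sub.
  by rewrite scaler_sumr; apply: eq_bigr => phi _; rewrite freeZE -mulrA.
rewrite !(@cp_funE (finsupp p `|` finsupp q));
  rewrite ?fsubsetUl ?fsubsetUr //; last exact: finsupp_sub.
by rewrite -big_split; apply: eq_bigr => phi _; rewrite freeDE mulrDl.
Qed.

HB.instance Definition _ := GRing.isSemilinear.Build S
  (mpolys S X) (mpolys S X ⊸ S^o) *:%R cp_curry cp_semilinear_l.

Definition cp : mpolys S X ⊗ mpolys S X ⊸ S^o := tensor_lift cp_curry.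

Lemma cpE p p' : cp (tens p p') = \sum_(phi \in [set: {mset X}]) p phi * p' phi.
Proof. by rewrite tensor_liftE. Qed.

End Comparison.

(* Main.v *)
From HB Require Import structures.
Require Import Defs.
From mathcomp Require Import all_boot all_algebra finmap multiset.
From mathcomp Require Import boolp.
Import GRing.Theory.
Local Open Scope mset_scope.
Local Open Scope ring_scope.

(** Multisets on [X + Y] are pairs of multisets on [X] and on [Y], and a linear
    map out of [S[X] ⊗ S[Y]] is freely determined by its values on the
    tensors of generators; so the inverse of the canonical map reads off the
    value of a relation at [1φ(κ₁-) ⊗ 1φ(κ₂-)]. The comparison relation takes
    the value 1 at [1φ ⊗ 1ψ] if [φ = ψ] and 0 otherwise. *)

Section MsetCoproduct.
Variables X Y : choiceType.

Lemma mset_inl_star (phi : {mset X}) (psi : {mset Y}) :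
  mset_inl (mset_star phi psi) = phi.
Proof. by apply/fsfunP => x; rewrite mset_inlE mset_star_inl. Qed.

Lemma mset_inr_star (phi : {mset X}) (psi : {mset Y}) :
  mset_inr (mset_star phi psi) = psi.
Proof. by apply/fsfunP => y; rewrite mset_inrE mset_star_inr. Qed.

Lemma mset_starK (phi : {mset X + Y}) :
  mset_star (mset_inl phi) (mset_inr phi) = phi.
Proof.
apply/fsfunP => -[x|y]; first by rewrite mset_star_inl mset_inlE.
by rewrite mset_star_inr mset_inrE.
Qed.

End MsetCoproduct.

Section CanonInverse.
Variables (S : comPzSemiRingType) (X Y : choiceType).

Definition canon_inv (r : mpolys S X ⊗ mpolys S Y ⊸ S^o) :
    fdistr S (X + Y)%type :=
  fun phi => r (tens (free_gen S (mset_inl phi)) (free_gen S (mset_inr phi))).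

(** Linear maps and formal distributions both carry pointwise operations, so the two laws hold by
    conversion. *)
Fact canon_inv_semilinear : semilinear canon_inv.
Proof. by split. Qed.

HB.instance Definition _ := GRing.isSemilinear.Build S
  (mpolys S X ⊗ mpolys S Y ⊸ S^o) (fdistr S (X + Y)%type) *:%R
  canon_inv canon_inv_semilinear.

Lemma canon_mapK : cancel (canon_map S X Y) canon_inv.
Proof.
by move=> p; apply/funext => phi; rewrite /canon_inv canon_mapE mset_starK.
Qed.

Lemma canon_invK : cancel canon_inv (canon_map S X Y).
Proof.
move=> r; apply: mpolys_tensor_eq => phi psi.
by rewrite canon_mapE /canon_inv mset_inl_star mset_inr_star.
Qed.

End CanonInverse.

Lemma cp_gen (S : comPzSemiRingType) (X : choiceType) (phi psi : {mset X}) :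
  cp S X (tens (free_gen S phi) (free_gen S psi)) =
  if phi == psi then 1 else 0.
Proof.
rewrite tensor_liftE -[LHS]/(cp_fun (free_gen S phi) (free_gen S psi)).
(* The support of a generator lies in [[fset phi]], which leaves only the term at [phi]. Inclusion
   suffices here; equality fails when [0 = 1] in [S], as the support is then empty. *)
rewrite (@cp_funE _ _ [fset phi]%fset); last exact: finsupp_sub.
rewrite big_seq_fset1 !free_genE eqxx mul1r.
by case: eqP.
Qed.

Theorem proposition4p9 (S : comPzSemiRingType) (X Y : choiceType) :
  linear_iso (canon_map S X Y) /\
  (forall p : fdistr S (X + X)%type,
     canon_map S X X p = cp S X <->
     p = (fun phi : {mset X + X} => if mset_inl phi == mset_inr phi then 1 else 0)).
Proof.
split; first by exists (canon_inv S X Y); split;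
  [exact: canon_mapK | exact: canon_invK].
(* Once the indicator function is known to be the inverse image of [cp], the two directions of the
   equivalence are the two cancellation laws. *)
have inv_cp : canon_inv S X X (cp S X) =
    fun phi => if mset_inl phi == mset_inr phi then 1 else 0.
  by apply/funext => phi; exact: cp_gen.
move=> p; rewrite -inv_cp; split=> [<-|->]; first by rewrite canon_mapK.
exact: canon_invK.
Qed.
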